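(* The functions $Q_k$ ($k = 0,1,2,\dots$) satisfy $Q_0(\gamma) = 1$ for all $\gamma > 0$ and, for every integer $k \ge 0$, the recurrence \[ Q_{k+1}(\gamma) = \int_\gamma^{1-k\gamma} \frac{1}{z}\, Q_k\!\left( \frac{\gamma}{1-z} \right) dz \quad \text{for } 0 < \gamma < \frac{1}{k+1}, \] and $Q_{k+1}(\gamma) = 0$ for $\gamma \ge \frac{1}{k+1}$.
   Context: For real $\gamma > 0$ and positive integer $n$, let $X^{(n)}$ be the number of cycles, in a permutation of $[n]=\{1,\dots,n\}$ chosen uniformly at random, whose length lies in $[\gamma n, n]$ (so $X^{(n)} = 0$ if $\gamma>1$). For each integer $k \ge 0$ define $Q_k(\gamma) = \lim_{n\to\infty} \mathbb{E}\left((X^{(n)})_k\right)$, where $(z)_k = z(z-1)\cdots(z-k+1)$ is the falling factorial, $(z)_0 = 1$; this limit exists and is finite. *)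

(* Defs.v *)
From HB Require Import structures.
From mathcomp Require Import all_boot all_order all_algebra all_fingroup.
From mathcomp Require Import all_classical all_reals all_analysis.
Import Order.TTheory GRing.Theory Num.Theory.
Import numFieldNormedType.Exports.

Set Implicit Arguments.
Unset Strict Implicit.
Unset Printing Implicit Defensive.

Local Open Scope ring_scope.

Definition num_long_cycles (R : realType) (gamma : R) (n : nat) (s : 'S_n) : nat :=
  #|[set c in porbits s | gamma * n%:R <= #|c|%:R <= (n%:R : R)]|.

Definition unif_expect (R : realType) (n : nat) (X : 'S_n -> R) : R :=
  (\sum_(s : 'S_n) X s) / #|{: 'S_n}|%:R.

(* [x ^_ k] is the falling factorial; it vanishes for [k > x], as (x)_k does
   at natural numbers x. *)
Definition factorial_moment (R : realType) (gamma : R) (k n : nat) : R :=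
  unif_expect (fun s : 'S_n => (num_long_cycles gamma s ^_ k)%:R).

(* [limn] is a junk value for divergent sequences: convergence has to be
   asserted separately. *)
Definition Q (R : realType) (k : nat) (gamma : R) : R :=
  limn (factorial_moment gamma k).

(* Main.v *)
Require Import Defs.
From HB Require Import structures.
From mathcomp Require Import all_boot all_order all_algebra all_fingroup.
From mathcomp Require Import all_classical all_reals all_analysis.
From mathcomp Require Import measurable_realfun.
From mathcomp Require Import ring lra.

(** Removing one cycle from a permutation turns a factorial moment of order
    [k + 1] into one of order [k].  A permutation with a marked cycle [C] is a
    cyclic permutation of [C], of which there are [(|C| - 1)!], together with
    an arbitrary permutation of the complement ([sum_split_cycle],
    [card_cycles_on]).  Since ['C(n, l) * (l - 1)! * (n - l)! = n! / l], the
    moment for the threshold [x] is the finite sum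
[[
      W x (k + 1) n = \sum_(l <= n, x <= l) W x k (n - l) / l,   W x 0 n = 1,
]]
    called [long_sum x k n] below; the factorial moment of the problem is
    [long_sum (gamma * n) k n] ([factorial_momentE]).

    The recurrence for [Q] is the limit of this one.  Put [l = z * n]: then
    [n / l] tends to [1 / z], and the threshold [gamma * n], measured against
    the [n - l = (1 - z) * n] remaining points, is the ratio
    [gamma / (1 - z)].  Hence the right-hand side is the integral over
    [[0, 1)] of a step function of [z] that converges pointwise to
    [1 / z * Q k (gamma / (1 - z))] for [z >= gamma] and to [0] below [gamma]
    ([step_height_cvg]).  These step functions are bounded by
    [gamma ^ -(k + 1)], so dominated convergence gives at once the existence of
    the limit [Q (k + 1) gamma], the integrability of the limit function and
    the integral formula over [[0, 1)] ([long_sum_cvg_integral]).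

    Pointwise convergence needs more than the convergence of the moments of
    order [k], because the ratio of the threshold to the number of remaining
    points is only asymptotically [gamma / (1 - z)].  Raising the threshold
    from [x] to [y] changes [long_sum] by at most
    [k (y - x + 1) / x * (n / x) ^ (k - 1)] ([long_sum_diff]), which is [O(1/n)]
    when [x] is of order [n] and [y - x] stays bounded; this absorbs the
    rounding.

    The same estimate gives [Q (k + 1) gamma = 0] for [gamma >= 1 / (k + 1)]:
    with the threshold [gamma * n + 1] there is no room for [k + 1] long cycles,
    so [long_sum] vanishes there, and lowering the threshold by [1] costs only
    [O(1/n)].  Consequently the integrand vanishes for [z >= 1 - k * gamma],
    which cuts the domain of integration down to [[gamma, 1 - k * gamma]]. *)

Set Implicit Arguments.
Unset Strict Implicit.
Unset Printing Implicit Defensive.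

Import Order.TTheory GRing.Theory Num.Theory.
Import numFieldNormedType.Exports.
Local Open Scope ring_scope.

(** * Splitting a permutation along one of its cycles *)

Lemma porbits_congr (T : finType) (s t : {perm T}) (D : {set T}) :
  {in D, s =1 t} -> D \in porbits s -> D \in porbits t.
Proof.
move=> st /imsetP[x _ eD]; apply/imsetP; exists x => //.
have it i : (t ^+ i)%g x = (s ^+ i)%g x.
  elim: i => [|i IH]; first by rewrite !expg0.
  by rewrite !expgSr !permM IH -st // eD mem_porbit.
rewrite eD; apply/setP => y.
by apply/porbitP/porbitP => -[i ->]; exists i; rewrite it.
Qed.

Lemma porbits_disjoint (T : finType) (s : {perm T}) (C D : {set T}) :
  C \in porbits s -> D \in porbits s -> C != D -> [disjoint C & D].
Proof.
move=> /imsetP[x _ ->] /imsetP[y _ ->]; apply: contraR.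
rewrite disjoint_sym => /pred0Pn[z /=/andP[]].
by rewrite -!eq_porbit_mem => /eqP <- /eqP ->.
Qed.

Lemma porbits_neq0 (T : finType) (s : {perm T}) (C : {set T}) :
  C \in porbits s -> (0 < #|C|)%N.
Proof. by case/imsetP => x _ ->; rewrite lt0n card_porbit_neq0. Qed.

Lemma porbits_stable (T : finType) (s : {perm T}) (C : {set T}) (x : T) :
  C \in porbits s -> (s x \in C) = (x \in C).
Proof.
case/imsetP => y _ ->.
by rewrite -!eq_porbit_mem -[in s x](expg1 s) porbit_perm.
Qed.

Definition cycles_on (T : finType) (C : {set T}) : {set {perm T}} :=
  [set c | perm_on C c & C \in porbits c].

(** Permutations of [A] are encoded as permutations of the whole type supported
    in [A], so that a cycle can be removed without changing the type; the
    restriction to cycles inside [A] discards the fixed points outside [A]. *)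
Definition cycles_in (T : finType) (P : pred nat) (A : {set T})
    (s : {perm T}) :=
  [set C in porbits s | (C \subset A) && P #|C|].

(** Permutations of [A] that have [C] as a cycle are the products of a cyclic
    permutation of [C] and a permutation of the rest: the two factors are
    recovered by restricting to [C] and to its complement, which are both stable
    because [C] is an orbit. *)
Lemma sum_split_cycle (R : nmodType) (T : finType) (A C : {set T})
    (f : {perm T} -> R) : C \subset A ->
  \sum_(s | perm_on A s && (C \in porbits s)) f s =
  \sum_(c in cycles_on C) \sum_(t | perm_on (A :\: C) t) f (c * t)%g.
Proof.
move=> sCA; rewrite pair_big /=.
have normC s : C \in porbits s -> s \in 'N(C | 'P)%g.
  move=> Cs; apply/astabsP => x /=; rewrite /aperm.
  exact: porbits_stable.
have normC' s : C \in porbits s -> s \in 'N(~: C | 'P)%g.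
  move=> Cs; apply/astabsP => x /=; rewrite /aperm !inE.
  by rewrite porbits_stable.
rewrite (reindex_onto (fun p : {perm T} * {perm T} => (p.1 * p.2)%g)
  (fun s => (restr_perm C s, restr_perm (~: C) s))) /=; last first.
  move=> s /andP[sA Cs]; apply/permP => x; rewrite permM.
  have [xC|xC] := boolP (x \in C).
    rewrite (restr_permE (normC s Cs)) // (out_perm (restr_perm_on _ _)) //.
    by rewrite inE negbK porbits_stable.
  by rewrite (out_perm (restr_perm_on C s) xC) (restr_permE (normC' s Cs)) ?inE.
apply: eq_bigl => -[c t] /=; rewrite inE.
apply/andP/andP => [[/andP[ctA Cct] /eqP[ec et]]|[/andP[cC Cc] tAC]].
  have cC : perm_on C c by rewrite -ec restr_perm_on.
  have tC : perm_on (~: C) t by rewrite -et restr_perm_on.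
  split; first rewrite cC /=.
    apply: (porbits_congr _ Cct) => x xC.
    by rewrite -[in RHS]ec (restr_permE (normC _ Cct)).
  apply/fintype.subsetP => x; rewrite !inE => tx.
  have xC : x \notin C.
    by move: tx; apply: contra => xC; rewrite (out_perm tC) // inE negbK.
  rewrite xC /=; apply: contraR tx => xA.
  by rewrite -[X in _ == X](out_perm ctA xA) permM (out_perm cC).
have tC : perm_on (~: C) t.
  by apply: (fintype.subset_trans tAC); rewrite finset.setDE subsetIr.
have tA : perm_on A t by apply: (fintype.subset_trans tAC); rewrite subsetDl.
have cA : perm_on A c by apply: (fintype.subset_trans cC).
have Cct : C \in porbits (c * t)%g.
  apply: (porbits_congr _ Cc) => x xC; rewrite permM [RHS](out_perm tC) //.
  by rewrite inE negbK perm_closed.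
split; first by rewrite perm_onM.
apply/eqP; congr pair; apply/permP => x.
  have [xC|xC] := boolP (x \in C).
    rewrite (restr_permE (normC _ Cct)) // permM (out_perm tC) //.
    by rewrite inE negbK perm_closed.
  by rewrite (out_perm (restr_perm_on C _) xC) (out_perm cC).
have [xC|xC] := boolP (x \in C).
  by rewrite (out_perm (restr_perm_on (~: C) _)) ?(out_perm tC) // inE negbK.
by rewrite (restr_permE (normC' _ Cct)) ?inE // permM (out_perm cC).
Qed.

Lemma card_cycles_in_mul (T : finType) (P : pred nat) (A C : {set T})
    (c t : {perm T}) : C \subset A -> P #|C| ->
    c \in cycles_on C -> perm_on (A :\: C) t ->
  #|cycles_in P A (c * t)%g| = #|cycles_in P (A :\: C) t|.+1.
Proof.
move=> sCA PC; rewrite inE => /andP[cC Cc] tAC.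
have Ct x : x \in C -> t x = x by move=> xC; rewrite (out_perm tAC) // !inE xC.
have Cct : C \in porbits (c * t)%g.
  apply: (porbits_congr _ Cc) => x xC; rewrite permM [RHS]Ct //.
  by rewrite perm_closed.
have ct : {in ~: C, (c * t)%g =1 t}.
  by move=> x; rewrite inE => xC; rewrite permM (out_perm cC).
rewrite (cardsD1 C) inE Cct sCA PC /= add1n; congr S; apply: eq_card => D.
rewrite !inE.
apply/idP/idP.
  case/and4P => DC Dct DA ->; rewrite andbT.
  have dDC := porbits_disjoint Dct Cct DC.
  rewrite subsetD DA dDC /= andbT; apply: porbits_congr Dct => x xD.
  by apply: ct; rewrite inE (disjointFr dDC).
case/and3P => Dt; rewrite subsetD => /andP[DA dDC] ->.
rewrite DA /= !andbT; apply/andP; split; last first.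
  apply: porbits_congr Dt => x xD.
  by rewrite ct // inE (disjointFr dDC).
apply: contraL dDC => /eqP ->.
by rewrite -setI_eq0 finset.setIid -card_gt0 (porbits_neq0 Cc).
Qed.

Lemma sum_subsets (R : nmodType) (T : finType) (A : {set T}) (f : nat -> R) :
  \sum_(C : {set T} | C \subset A) f #|C| =
  \sum_(j < #|A|.+1) f j *+ 'C(#|A|, j).
Proof.
rewrite (partition_big (fun C : {set T} => inord #|C| : 'I_#|A|.+1) predT) //=.
apply: eq_bigr => j _; rewrite -cards_draws -sumr_const.
have inordE (C : {set T}) : C \subset A -> (inord #|C| == j) = (#|C| == j).
  by move=> /subset_leq_card CA; rewrite -val_eqE /= inordK.
rewrite (eq_bigr (fun=> f j)); last first.
  by move=> C /andP[CA]; rewrite inordE // => /eqP ->.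
apply: eq_bigl => C; rewrite inE.
by case CA: (C \subset A) => //=; apply: inordE.
Qed.

(** Classifying the [|A|!] permutations of [A] by the cycle [C] through a chosen
    element [x] expresses [|A|!] as a sum over [C] in which the number of cyclic
    permutations of [A] is the only unknown, by induction.  The values
    [(|C| - 1)!] satisfy the same equation, since ['C(|A| - 1, j)] of the sets
    [C] have [j + 1] elements, and
    ['C(|A| - 1, j) * j! * (|A| - 1 - j)! = (|A| - 1)!]. *)
Lemma card_cycles_on (T : finType) (C : {set T}) :
  (0 < #|C|)%N -> #|cycles_on C| = (#|C|.-1)`!.
Proof.
have [m] := ubnP #|C|; elim: m C => // m IH A Am A0.
have /card_gt0P[x xA] := A0.
have split_at_x : (#|A|)`! =
    (\sum_(C : {set T} | (C \subset A) && (x \in C))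
       #|cycles_on C| * (#|A| - #|C|)`!)%N.
  rewrite -card_perm; transitivity (\sum_(s | perm_on A s) 1)%N.
    by rewrite sum1_card.
  rewrite (partition_big (fun s => porbit s x)
     (fun C : {set T} => (C \subset A) && (x \in C))) /=; last first.
    move=> s sA; rewrite porbit_id andbT; apply/fintype.subsetP => y.
    case/porbitP => i ->; elim: i => [|i yA]; first by rewrite expg0 perm1.
    by rewrite expgSr permM (perm_closed _ sA).
  apply: eq_bigr => C /andP[CA xC].
  transitivity (\sum_(s | perm_on A s && (C \in porbits s)) 1)%N.
    apply: eq_bigl => s; congr andb; apply/eqP/idP => [<-|].
      by apply/imsetP; exists x.
    by case/imsetP => y _ Cy; move: xC; rewrite Cy -eq_porbit_mem => /eqP.
  rewrite sum_split_cycle // (eq_bigr (fun=> (#|A| - #|C|)`!)).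
    by rewrite sum_nat_const.
  move=> c _; rewrite sum1_card card_perm cardsD.
  by rewrite (finset.setIidPr CA).
have total : (\sum_(C : {set T} | (C \subset A) && (x \in C))
       (#|C|.-1)`! * (#|A| - #|C|)`! = (#|A|)`!)%N.
  (* Sets containing [x] are indexed by their other elements. *)
  rewrite (reindex_onto (fun B => x |: B) (fun C => C :\ x)) /=; last first.
    by move=> C /andP[_ xC]; rewrite finset.setD1K.
  transitivity (\sum_(B : {set T} | B \subset A :\ x)
      (#|B|)`! * (#|A|.-1 - #|B|)`!)%N.
    apply: eq_big => [B|B].
      rewrite finset.subUset finset.sub1set xA setU11 andbT subsetD1 /=.
      by congr andb; apply/eqP/idP => [<-|/setU1K//]; rewrite setD11.
    rewrite finset.subUset => /andP[/andP[/andP[_ BA] _] /eqP xB].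
    have {}xB : x \notin B by rewrite -xB setD11.
    by rewrite cardsU1 xB add1n subnS predn_sub.
  rewrite (sum_subsets (A :\ x) (fun j => j`! * (#|A|.-1 - j)`!)%N).
  have -> : #|A :\ x| = #|A|.-1 by rewrite (cardsD1 x A) xA.
  rewrite (eq_bigr (fun=> (#|A|.-1)`!)) => [|j _]; last first.
    rewrite -mulr_natr natn mulrC; apply: bin_fact.
    by rewrite -ltnS.
  by rewrite sum_nat_const card_ord -factS prednK.
apply/eqP; rewrite -(eqn_add2r (\sum_(C : {set T} |
    ((C \subset A) && (x \in C)) && (C != A))
    (#|C|.-1)`! * (#|A| - #|C|)`!)%N); apply/eqP.
move: split_at_x; rewrite -[in LHS]total.
rewrite (bigD1 A) ?subxx //= [RHS](bigD1 A) ?subxx //=.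
rewrite subnn !muln1 => ->; congr addn.
apply: eq_bigr => C /andP[/andP[CA xC] nCA]; rewrite IH //.
  apply: (@leq_trans #|A|); last by rewrite -ltnS.
  by apply: proper_card; rewrite finset.properEneq nCA.
by apply/card_gt0P; exists x.
Qed.

(** The sum of [1 / (l_1 * .. * l_k)] over all [k]-tuples of positive integers
    in [P] with [l_1 + .. + l_k <= n]: the expected number of ordered
    [k]-tuples of distinct cycles with lengths in [P] in a uniform permutation
    of [n] points. *)
Fixpoint cycle_sum (R : numFieldType) (P : pred nat) (k n : nat) : R :=
  if k is k'.+1 then
    \sum_(l < n | P l.+1) l.+1%:R^-1 * cycle_sum R P k' (n - l.+1)
  else 1.

(** Let [X] be the number of cycles with length in [P].  In
    [(X)_(k+1) = X * (X - 1)_k], write the factor [X] as a sum over the cycles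
    [C] that it counts; then [X - 1] is the count for the permutation of the
    complement of [C]. *)
Lemma sum_ffact_cycles (R : numFieldType) (T : finType) (P : pred nat)
    (k : nat) (A : {set T}) :
  \sum_(s | perm_on A s) (#|cycles_in P A s| ^_ k)%:R =
  (#|A|)`!%:R * cycle_sum R P k #|A|.
Proof.
elim: k A => [|k IH] A.
  under eq_bigr do rewrite ffactn0.
  by rewrite mulr1 -card_perm -sumr_const; apply: eq_bigl.
transitivity (\sum_(C : {set T} | C \subset A)
    (if (0 < #|C|)%N && P #|C| then (#|C|.-1)`!%:R * ((#|A| - #|C|)`!%:R *
      cycle_sum R P k (#|A| - #|C|)) else 0)).
  transitivity (\sum_(s | perm_on A s) \sum_(C in cycles_in P A s)
      (#|cycles_in P A s|.-1 ^_ k)%:R : R).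
    by apply: eq_bigr => s _; rewrite ffactnS natrM sumr_const mulr_natl.
  rewrite (exchange_big_dep (fun C : {set T} => C \subset A)) /=; last first.
    by move=> s C _; rewrite inE => /andP[_ /andP[]].
  apply: eq_bigr => C CA.
  case: ifP => [/andP[C0 PC]|nC]; last first.
    rewrite big1 // => s /andP[_]; rewrite inE CA /= => /andP[Cs PC].
    by move: nC; rewrite PC (porbits_neq0 Cs).
  transitivity (\sum_(s | perm_on A s && (C \in porbits s))
      (#|cycles_in P A s|.-1 ^_ k)%:R : R).
    by apply: eq_bigl => s; rewrite inE CA PC !andbT.
  rewrite sum_split_cycle // -card_cycles_on // mulr_natl -sumr_const.
  apply: eq_bigr => c cC.
  transitivity (\sum_(t | perm_on (A :\: C) t)
      (#|cycles_in P (A :\: C) t| ^_ k)%:R : R).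
    by apply: eq_bigr => t tAC; rewrite (card_cycles_in_mul CA PC cC tAC).
  by rewrite IH cardsD (finset.setIidPr CA).
rewrite (sum_subsets A (fun j => if (0 < j)%N && P j then (j.-1)`!%:R *
  ((#|A| - j)`!%:R * cycle_sum R P k (#|A| - j)) else 0)).
rewrite big_ord_recl /= mul0rn add0r mulr_sumr [RHS]big_mkcond /=.
apply: eq_bigr => j _; rewrite /bump leq0n add1n.
case: ifP => _; last by rewrite mul0rn.
rewrite -(bin_fact (ltn_ord j)) factS !natrM -mulr_natl.
by field; rewrite nat1r pnatr_eq0.
Qed.

(** * The finite moments as functions of the threshold *)

Definition long_sum (R : realFieldType) (x : R) (k n : nat) : R :=
  cycle_sum R (fun l => x <= l%:R) k n.

Lemma long_sumS (R : realFieldType) (x : R) (k n : nat) :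
  long_sum x k.+1 n =
  \sum_(l < n) (if x <= l.+1%:R then l.+1%:R^-1 * long_sum x k (n - l.+1)
                else 0).
Proof. by rewrite -big_mkcond. Qed.

Lemma long_sum_ge0 (R : realFieldType) (x : R) (k n : nat) :
  0 <= long_sum x k n.
Proof.
elim: k n => [|k IH] n; first exact: ler01.
rewrite long_sumS sumr_ge0 // => l _; case: ifP => // _.
by rewrite mulr_ge0 ?invr_ge0 ?ler0n ?IH.
Qed.

(** [k] long cycles need at least [k * x] points. *)
Lemma long_sum_eq0 (R : realFieldType) (x : R) (k n : nat) :
  n%:R < k%:R * x -> long_sum x k n = 0.
Proof.
elim: k n => [|k IH] n; first by rewrite mul0r ltNge ler0n.
move=> nkx; rewrite long_sumS big1 // => l _; case: ifP => // xl.
rewrite IH ?mulr0 // natrB // ltrBlDr (lt_le_trans nkx) //.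
by rewrite -natr1 mulrDl mul1r lerD2l.
Qed.

Lemma long_sum_le (R : realFieldType) (x : R) (k n : nat) : 0 < x ->
  long_sum x k n <= (n%:R / x) ^+ k.
Proof.
move=> x0; elim: k n => [|k IH] n; first by rewrite expr0.
rewrite long_sumS exprS -mulrA mulr_natl.
rewrite -[n in _ *+ n]card_ord -sumr_const; apply: ler_sum => l _.
have xV0 : 0 <= x^-1 by rewrite invr_ge0 ltW.
have P0 : 0 <= (n%:R / x) ^+ k by rewrite exprn_ge0 // mulr_ge0.
case: ifP => [xl|_]; last by rewrite mulr_ge0.
rewrite ler_pM ?invr_ge0 ?ler0n ?long_sum_ge0 //.
  by rewrite lef_pV2 // posrE.
apply: (le_trans (IH _)); rewrite lerXn2r ?nnegrE ?mulr_ge0 //.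
by rewrite ler_wpM2r // ler_nat leq_subr.
Qed.

(** The bound [n - x + 1] carries the induction on [n]: when [n + 1] is itself
    counted, the integers counted before it lie between [x] and [n], and
    [n + 1 < y]. *)
Lemma count_le (R : realFieldType) (x y : R) (n : nat) : x <= y ->
  \sum_(l < n) ((x <= l.+1%:R < y)%R%:R : R) <= y - x + 1.
Proof.
move=> xy.
suff : \sum_(l < n) ((x <= l.+1%:R < y)%R%:R : R) <= y - x + 1 /\
    \sum_(l < n) ((x <= l.+1%:R < y)%R%:R : R) <= Num.max 0 (n%:R - x + 1).
  by case.
elim: n => [|n [IH1 IH2]].
  by rewrite big_ord0 le_max lexx; split=> //; lra.
rewrite big_ord_recr /=.
case: (boolP (x <= n.+1%:R < y)) => /= [/andP[xn ny]|_]; last first.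
  rewrite addr0.
  split=> //; apply: (le_trans IH2).
  by rewrite ge_max !le_max lexx /=; apply/orP; right; rewrite -natr1; lra.
have n1 : n.+1%:R = n%:R + 1 :> R by rewrite natr1.
rewrite n1 in xn ny *.
have bnd : \sum_(l < n) ((x <= l.+1%:R < y)%R%:R : R) <= n%:R - x + 1.
  by apply: (le_trans IH2); rewrite ge_max lexx andbT; lra.
by split; [lra|rewrite le_max; apply/orP; right; lra].
Qed.

(** Stability of the moments under a change of threshold.  In the recursion, the
    terms with [x <= l < y] are lost: there are at most [y - x + 1] of them,
    each at most [1 / x * (n / x) ^ k].  The at most [n] other terms change by
    at most [1 / x] times the bound for the previous order. *)
Lemma long_sum_diff (R : realFieldType) (x y : R) (k n : nat) :
  0 < x -> x <= y ->
  0 <= long_sum x k n - long_sum y k n <=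
    k%:R * ((y - x + 1) / x) * (n%:R / x) ^+ k.-1.
Proof.
move=> x0 xy; elim: k n => [|k IH] n.
  by rewrite /long_sum /= subrr mul0r mul0r lexx.
have xV0 : 0 <= x^-1 by rewrite invr_ge0 ltW.
have n0 : 0 <= n%:R / x by rewrite mulr_ge0.
have d0 : 0 <= (y - x + 1) / x by rewrite mulr_ge0 //; lra.
rewrite !long_sumS -sumrB; apply/andP; split.
  apply: sumr_ge0 => l _; case: (leP y l.+1%:R) => [yl|_].
    have xl := le_trans xy yl.
    rewrite xl -mulrBr mulr_ge0 ?invr_ge0 ?ler0n //.
    by case/andP: (IH (n - l.+1)%N).
  rewrite subr0; case: ifP => // _.
  by rewrite mulr_ge0 ?invr_ge0 ?ler0n ?long_sum_ge0.
apply: (@le_trans _ _ (\sum_(l < n)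
  ((x <= l.+1%:R < y)%R%:R * (x^-1 * (n%:R / x) ^+ k) +
    x^-1 * (k%:R * ((y - x + 1) / x) * (n%:R / x) ^+ k.-1)))).
  apply: ler_sum => l _.
  have lV : (x <= l.+1%:R) -> 0 <= l.+1%:R^-1 :> R /\ l.+1%:R^-1 <= x^-1.
    by move=> xl; rewrite invr_ge0 ler0n lef_pV2 // posrE.
  have nl : (n - l.+1)%:R / x <= n%:R / x.
    by rewrite ler_wpM2r // ler_nat leq_subr.
  have nl0 : 0 <= (n - l.+1)%:R / x by rewrite mulr_ge0.
  have R0 : 0 <= x^-1 * (k%:R * ((y - x + 1) / x) * (n%:R / x) ^+ k.-1).
    by rewrite !mulr_ge0 ?exprn_ge0 //; lra.
  case: (leP y l.+1%:R) => [yl|_].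
    have xl := le_trans xy yl; have [l0 l1] := lV xl.
    rewrite xl /= mul0r add0r -mulrBr.
    have /andP[D0 D1] := IH (n - l.+1)%N.
    apply: ler_pM => //; apply: (le_trans D1).
    by rewrite ler_wpM2l ?mulr_ge0 ?ler0n ?lerXn2r ?nnegrE //; lra.
  rewrite subr0 andbT; case: ifP => [xl|_] /=; last by rewrite mul0r add0r.
  have [l0 l1] := lV xl.
  rewrite mul1r -[X in X <= _]addr0 lerD //.
  rewrite ler_pM ?long_sum_ge0 //; apply: (le_trans (long_sum_le _ _ x0)).
  by rewrite lerXn2r ?nnegrE.
rewrite big_split /= -mulr_suml sumr_const card_ord -[X in _ + X <= _]mulr_natl.
apply: (@le_trans _ _ ((y - x + 1) * (x^-1 * (n%:R / x) ^+ k) + n%:R *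
     (x^-1 * (k%:R * ((y - x + 1) / x) * (n%:R / x) ^+ k.-1)))).
  by rewrite lerD2r ler_wpM2r ?count_le // mulr_ge0 ?exprn_ge0.
rewrite le_eqVlt; apply/orP; left; apply/eqP.
case: k {IH} => [|k] /=; first by rewrite !expr0; ring.
rewrite -[k.+2%:R]natr1 exprS; ring.
Qed.

Lemma factorial_momentE (R : realType) (gamma : R) (k n : nat) :
  factorial_moment gamma k n = long_sum (gamma * n%:R) k n.
Proof.
have := sum_ffact_cycles R (fun l => gamma * n%:R <= l%:R) k [set: 'I_n]%SET.
rewrite cardsT card_ord => e.
rewrite /factorial_moment /unif_expect card_Sn.
apply: canLR (mulfK _) _; first by rewrite pnatr_eq0 -lt0n fact_gt0.
rewrite mulrC -[RHS]e; apply: eq_big => s.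
  by apply/esym/fintype.subsetP => x _; rewrite inE.
move=> _; congr (_ ^_ k)%:R; apply: eq_card => c; rewrite !inE.
rewrite finset.subsetT /=; congr andb; rewrite ler_nat.
by rewrite -[X in (_ <= X)%N]card_ord max_card andbT.
Qed.

(** * Rounding and rescaling of the threshold *)

Local Open Scope classical_set_scope.
Local Open Scope ring_scope.

Lemma truncn_mul_lt (R : realType) (z : R) (n : nat) :
  0 <= z < 1 -> (0 < n)%N ->
  (Num.truncn (z * n%:R) < n)%N.
Proof.
move=> /andP[z0 z1] n0; rewrite -(ltr_nat R).
have zn0 : 0 <= z * n%:R by rewrite mulr_ge0.
have /andP[le _] := truncn_itv zn0.
by rewrite (le_lt_trans le) // gtr_pMl // ltr0n.
Qed.

Lemma inv_nat_cvg (R : realType) : (n%:R^-1 : R) @[n --> \oo] --> 0.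
Proof.
apply/gtr0_cvgV0; last exact: cvgr_idn.
by near=> n; rewrite ltr0n; near: n; exact: nbhs_infty_gt.
Unshelve. all: by end_near. Qed.

Lemma truncnS_div_cvg (R : realType) (z : R) : 0 <= z ->
  ((Num.truncn (z * n%:R)).+1%:R / n%:R) @[n --> \oo] --> z.
Proof.
move=> z0.
apply: (@squeeze_cvgr _ _ _ _ (fun=> z) (fun n => z + n%:R^-1)).
- near=> n.
  have n0 : 0 < n%:R :> R by rewrite ltr0n; near: n; exact: nbhs_infty_gt.
  have zn0 : 0 <= z * n%:R by rewrite mulr_ge0 // ltW.
  have /andP[t1 t2] := truncn_itv zn0.
  rewrite ler_pdivlMr // (ltW t2) /= ler_pdivrMr // mulrDl mulVf ?gt_eqF //.
  by rewrite -natr1 lerD2r.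
- exact: cvg_cst.
- rewrite -[X in _ --> X]addr0; apply: cvgD; first exact: cvg_cst.
  exact: inv_nat_cvg.
Unshelve. all: by end_near. Qed.

Lemma sub_truncnS_bounds (R : realType) (z : R) (n : nat) :
  0 <= z < 1 -> (0 < n)%N ->
  (1 - z) * n%:R - 1 <= (n - (Num.truncn (z * n%:R)).+1)%:R <= (1 - z) * n%:R.
Proof.
move=> z01 n0; have z0 : 0 <= z by case/andP: z01.
have zn0 : 0 <= z * n%:R by rewrite mulr_ge0.
have /andP[t1 t2] := truncn_itv zn0.
rewrite natrB; last exact: truncn_mul_lt.
rewrite -natr1 in t2 *; apply/andP; split; lra.
Qed.

Lemma sub_truncnS_cvgny (R : realType) (z : R) : 0 <= z < 1 ->
  (n - (Num.truncn (z * n%:R)).+1)%N @[n --> \oo] --> \oo.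
Proof.
move=> z01; apply/cvgnyPge => A; near=> n.
have n0 : (0 < n)%N by near: n; exact: nbhs_infty_gt.
have /andP[lb _] := sub_truncnS_bounds z01 n0.
rewrite -(ler_nat R); apply: le_trans lb.
have : (A%:R + 1) / (1 - z) < n%:R by near: n; exact: nbhs_infty_gtr.
rewrite ltr_pdivrMr; last by case/andP: z01; lra.
by lra.
Unshelve. all: by end_near. Qed.

(** The threshold [gamma * n] may be replaced by the threshold proportional to
    the number [m] of remaining points: with [d = gamma / (1 - z)], rounding
    gives [(1 - z) * n - 1 <= m <= (1 - z) * n], so the two thresholds
    [d * m <= gamma * n] differ by at most [d], and [long_sum_diff] bounds the
    error by a multiple of [1 / m]. *)
Lemma long_sum_rescale (R : realType) (gamma z q : R) (k : nat) :
  0 < gamma -> 0 <= z < 1 ->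
  long_sum (gamma / (1 - z) * m%:R) k m @[m --> \oo] --> q ->
  long_sum (gamma * n%:R) k (n - (Num.truncn (z * n%:R)).+1) @[n --> \oo] --> q.
Proof.
move=> g0 z01; have /andP[z0 z1] := z01; set d := gamma / (1 - z) => cvq.
have d0 : 0 < d by rewrite divr_gt0 // subr_gt0.
pose m n := (n - (Num.truncn (z * n%:R)).+1)%N.
have cvm : m n @[n --> \oo] --> \oo := sub_truncnS_cvgny z01.
pose e n := long_sum (d * (m n)%:R) k (m n) - long_sum (gamma * n%:R) k (m n).
have cve : e n @[n --> \oo] --> 0.
  pose C := k%:R * ((d + 1) / d) * d^-1 ^+ k.-1.
  apply: (@squeeze_cvgr _ _ _ _ (fun=> 0) (fun n => C * (m n)%:R^-1)).
  - near=> n.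
    have n0 : (0 < n)%N by near: n; exact: nbhs_infty_gt.
    have m0 : 0 < (m n)%:R :> R.
      by rewrite ltr0n; near: n; move/cvgnyPgt : cvm; apply.
    have /andP[lb ub] := sub_truncnS_bounds z01 n0; rewrite -/(m n) in lb ub.
    have gE : gamma = d * (1 - z) by rewrite /d divfK // gt_eqF // subr_gt0.
    have x0 : 0 < d * (m n)%:R by rewrite mulr_gt0.
    have xy : d * (m n)%:R <= gamma * n%:R.
      by rewrite gE -mulrA ler_wpM2l // ltW.
    have yx : gamma * n%:R - d * (m n)%:R <= d.
      rewrite gE -mulrA -mulrBr -[X in _ <= X]mulr1.
      by rewrite ler_wpM2l ?(ltW d0) //; lra.
    have /andP[e0 e1] := long_sum_diff k (m n) x0 xy.
    rewrite /e e0 /=; apply: (le_trans e1).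
    have -> : (m n)%:R / (d * (m n)%:R) = d^-1.
      by field; rewrite !gt_eqF.
    have -> : C / (m n)%:R = k%:R * ((d + 1) / (d * (m n)%:R)) * d^-1 ^+ k.-1.
      by rewrite /C; move: (d^-1 ^+ k.-1) => P; field; rewrite !gt_eqF.
    rewrite ler_wpM2r ?exprn_ge0 ?invr_ge0 ?(ltW d0) //.
    rewrite ler_wpM2l // ler_wpM2r ?invr_ge0 ?(ltW x0) //; lra.
  - exact: cvg_cst.
  - rewrite -[X in _ --> X](mulr0 C); apply: cvgM; first exact: cvg_cst.
    exact: (cvg_comp _ _ cvm (@inv_nat_cvg R)).
rewrite -[X in _ --> X]subr0.
rewrite (_ : (fun n => _) = (fun n => long_sum (d * (m n)%:R) k (m n) - e n)).
  by apply: cvgB => //; exact: (cvg_comp _ _ cvm cvq).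
by apply/funext => n; rewrite /e opprB addrC subrK.
Unshelve. all: by end_near. Qed.

(** * Sums as integrals of step functions *)

(** A combination of indicators is visibly measurable and easy to integrate;
    limits are taken in the pointwise form [step_funE], where [l] is the integer
    part of [z * n]. *)
Definition step_fun (R : realType) (h : nat -> R) (n : nat) (z : R) : R :=
  \sum_(l < n) h l * \1_(`[l%:R / n%:R, l.+1%:R / n%:R[ : set R) z.

Lemma step_funE (R : realType) (h : nat -> R) (n : nat) (z : R) :
  0 <= z < 1 -> (0 < n)%N -> step_fun h n z = h (Num.truncn (z * n%:R)).
Proof.
move=> z01 n0; have z0 : 0 <= z by case/andP: z01.
have nn0 : 0 < n%:R :> R by rewrite ltr0n.
have zn0 : 0 <= z * n%:R by rewrite mulr_ge0.
rewrite /step_fun (bigD1 (Ordinal (truncn_mul_lt z01 n0))) //= big1 ?addr0.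
  rewrite indicE mem_set ?mulr1 //= in_itv /= ler_pdivrMr // ltr_pdivlMr //.
  exact: truncn_itv.
move=> i; rewrite -val_eqE /= => ne; rewrite indicE memNset ?mulr0 //=.
rewrite in_itv /= ler_pdivrMr // ltr_pdivlMr // => /truncn_def e.
by rewrite e eqxx in ne.
Qed.

Lemma measurable_step_fun (R : realType) (h : nat -> R) (n : nat) (D : set R) :
  measurable_fun D (step_fun h n).
Proof.
apply: measurable_sum => l; apply: measurable_funM; first exact: measurable_cst.
exact: measurable_indic.
Qed.

Lemma integral_step_fun (R : realType) (h : nat -> R) (n : nat) :
  (forall l, 0 <= h l) ->
  (\int[lebesgue_measure]_(z in `[0%R, 1%R[) (step_fun h n z)%:E)%E =
  ((\sum_(l < n) h l) / n%:R)%:E.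
Proof.
move=> h0.
have [->|n0] := posnP n.
  rewrite big_ord0 mul0r.
  under eq_integral => z _ do rewrite /step_fun big_ord0.
  by rewrite integral0.
have nn0 : 0 < n%:R :> R by rewrite ltr0n.
have xn0 : n%:R != 0 :> R by rewrite gt_eqF.
under eq_integral => z _ do rewrite /step_fun -sumEFin.
rewrite ge0_integral_sum //=; last 2 first.
- move=> l; apply/measurable_EFinP; apply: measurable_funM.
    exact: measurable_cst.
  exact: measurable_indic.
- by move=> l z _; rewrite lee_fin mulr_ge0.
rewrite mulr_suml -sumEFin; apply: eq_bigr => l _.
rewrite (integralZl_indic _ (fun=> `[l%:R / n%:R, l.+1%:R / n%:R[%classic
  : set (measurableTypeR R))) //=; last first.
  by move=> hl; move: (h0 l); rewrite leNgt hl.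
rewrite integral_indic //= setIidl; last first.
  move=> z /=; rewrite !in_itv /= => /andP[z1 z2]; apply/andP; split.
    by apply: le_trans z1; rewrite mulr_ge0 // invr_ge0 ltW.
  apply: (lt_le_trans z2); rewrite ler_pdivrMr // mul1r ler_nat //.
rewrite lebesgue_measure_itv /= lte_fin ltr_pM2r ?invr_gt0 // ltr_nat leqnn.
rewrite -EFinD -EFinM; congr EFin.
by rewrite -mulrBl -natrB // subSnn mul1r.
Qed.

(** * Passage to the limit *)

(** The term of the recursion for a cycle of length [l + 1], multiplied by [n]:
    the sum over [l] becomes the integral of the step function of mesh
    [1 / n]. *)
Definition step_height (R : realType) (gamma : R) (k n l : nat) : R :=
  if gamma * n%:R <= l.+1%:R
  then n%:R / l.+1%:R * long_sum (gamma * n%:R) k (n - l.+1) else 0.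

(** The threshold controls both factors: [n / (l + 1) <= 1 / gamma] for every
    term that is present, and the remaining moment is at most
    [gamma ^ - k].  This is the dominating constant. *)
Lemma step_height_bounds (R : realType) (gamma : R) (k n l : nat) :
  0 < gamma -> 0 <= step_height gamma k n l <= gamma^-1 ^+ k.+1.
Proof.
move=> g0; have gV : 0 <= gamma^-1 by rewrite invr_ge0 ltW.
rewrite /step_height; case: ifP => [gl|_]; last by rewrite lexx exprn_ge0.
rewrite !mulr_ge0 ?invr_ge0 ?long_sum_ge0 //=.
have [->|n0] := posnP n; first by rewrite !mul0r exprn_ge0.
have nn0 : 0 < n%:R :> R by rewrite ltr0n.
have x0 : 0 < gamma * n%:R by rewrite mulr_gt0.
rewrite exprS ler_pM ?mulr_ge0 ?invr_ge0 ?long_sum_ge0 //.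
  by rewrite ler_pdivrMr // ler_pdivlMl // mulrC.
apply: (le_trans (long_sum_le _ _ x0)); rewrite lerXn2r ?nnegrE //.
  by rewrite mulr_ge0 // invr_ge0 ltW.
by rewrite ler_pdivrMr // mulrA mulVf ?gt_eqF // mul1r ler_nat leq_subr.
Qed.

Lemma sum_step_height (R : realType) (gamma : R) (k n : nat) :
  (\sum_(l < n) step_height gamma k n l) / n%:R =
  long_sum (gamma * n%:R) k.+1 n.
Proof.
have [->|n0] := posnP n; first by rewrite long_sumS !big_ord0 mul0r.
rewrite long_sumS mulr_suml; apply: eq_bigr => l _.
rewrite /step_height; case: ifP => _; last by rewrite mul0r.
by field; rewrite nat1r !pnatr_eq0 -!lt0n n0.
Qed.

Definition limit_height (R : realType) (gamma : R) (k : nat) (z : R) : R :=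
  if gamma <= z then 1 / z * Q k (gamma / (1 - z)) else 0.

(** Above [gamma] the two factors converge separately, the moments by
    [long_sum_rescale].  For [z < gamma] the steps are eventually [0]: the
    integer part of [z * n] plus one stays below [gamma * n] once [n] exceeds
    [1 / (gamma - z)]. *)
Lemma step_height_cvg (R : realType) (gamma : R) (k : nat) (z : R) :
  (forall d : R, 0 < d -> cvgn (factorial_moment d k)) ->
  0 < gamma -> 0 <= z < 1 ->
  step_fun (step_height gamma k n) n z @[n --> \oo] --> limit_height gamma k z.
Proof.
move=> cvk g0 z01; have /andP[z0 z1] := z01.
apply: (@cvg_trans _
  (step_height gamma k n (Num.truncn (z * n%:R)) @[n --> \oo])).
  apply: near_eq_cvg; near=> n; apply/esym/step_funE => //.
  by near: n; exact: nbhs_infty_gt.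
rewrite /limit_height; case: ifPn => [gz|]; last rewrite -ltNge => zg.
  have zz0 : 0 < z by exact: lt_le_trans gz.
  apply: (@cvg_trans _ ((n%:R / (Num.truncn (z * n%:R)).+1%:R *
     long_sum (gamma * n%:R) k (n - (Num.truncn (z * n%:R)).+1)) @[n --> \oo])).
    apply: near_eq_cvg; apply: nearW => n; rewrite /step_height ifT //.
    have zn0 : 0 <= z * n%:R by rewrite mulr_ge0.
    have /andP[_ /ltW] := truncn_itv zn0; apply: le_trans.
    by rewrite ler_wpM2r.
  apply: cvgM.
    rewrite div1r; under eq_fun do rewrite -invf_div.
    apply: cvgV; first by rewrite gt_eqF.
    exact: truncnS_div_cvg.
  apply: long_sum_rescale => //.
  have d0 : 0 < gamma / (1 - z) by rewrite divr_gt0 // subr_gt0.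
  rewrite (_ : (fun m => _) = factorial_moment (gamma / (1 - z)) k).
    exact: cvk.
  by apply/funext => m; rewrite factorial_momentE.
apply: (@cvg_trans _ ((0 : R) @[n --> \oo])); last exact: cvg_cst.
apply: near_eq_cvg; near=> n; rewrite /step_height ifF //.
apply/negbTE; rewrite -ltNge -natr1.
have zn0 : 0 <= z * n%:R by rewrite mulr_ge0.
have /andP[t _] := truncn_itv zn0.
have : 1 / (gamma - z) < n%:R by near: n; exact: nbhs_infty_gtr.
rewrite ltr_pdivrMr; last by lra.
by lra.
Unshelve. all: by end_near. Qed.

(** Dominated convergence for the step functions, as one step of the induction
    on [k].  All ratios [d] are needed at order [k], since [gamma / (1 - z)]
    runs through an interval; measurability comes for free, the limit function
    being a pointwise limit of step functions. *)
Lemma long_sum_cvg_integral (R : realType) (gamma : R) (k : nat) :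
  (forall d : R, 0 < d -> cvgn (factorial_moment d k)) -> 0 < gamma ->
  (@lebesgue_measure R).-integrable `[0, 1[ (EFin \o limit_height gamma k) /\
  factorial_moment gamma k.+1 @ \oo -->
    \int[@lebesgue_measure R]_(z in `[0, 1[) limit_height gamma k z.
Proof.
move=> cvk g0.
pose f_ n z := (step_fun (step_height gamma k n) n z)%:E.
have mf n : measurable_fun (`[0, 1[%classic : set R) (f_ n).
  by apply/measurable_EFinP; exact: measurable_step_fun.
have cvf z : z \in `[0, 1[ ->
    f_ n z @[n --> \oo] --> (limit_height gamma k z)%:E.
  move=> z01; apply: cvg_EFin; first exact: nearW.
  by apply: step_height_cvg.
have bnd n z : z \in `[0, 1[ -> (`|f_ n z| <= (gamma^-1 ^+ k.+1)%:E)%E.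
  move=> z01; rewrite /f_ abse_EFin lee_fin.
  have [->|n0] := posnP n.
    by rewrite /step_fun big_ord0 normr0 exprn_ge0 // invr_ge0 ltW.
  rewrite step_funE //.
  have /andP[a b] := step_height_bounds k n (Num.truncn (z * n%:R)) g0.
  by rewrite ger0_norm.
have [] := @dominated_convergence _ _ R (@lebesgue_measure R) `[0, 1[%classic _
  f_ (EFin \o limit_height gamma k) (cst (gamma^-1 ^+ k.+1)%:E) mf.
- by [].
- apply: emeasurable_fun_cvg mf _ => z z01; exact: cvf.
- by apply: aeW => z z01; exact: cvf.
- apply: measurable_bounded_integrable => //.
    by rewrite /= lebesgue_measure_itv /= lte_fin ltr01 oppr0 adde0 ltry.
  exact: bounded_cst.
- by apply: aeW => z n z01; exact: bnd.
move=> intf _ cvI; split => //.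
have finI : (\int[@lebesgue_measure R]_(z in `[0%R, 1%R[)
    (limit_height gamma k z)%:E)%E \is a fin_num.
  exact: integrable_fin_num.
have : (factorial_moment gamma k.+1 n)%:E @[n --> \oo] -->
   (\int[@lebesgue_measure R]_(z in `[0%R, 1%R[) limit_height gamma k z)%:E.
  rewrite /Rintegral fineK //.
  apply: cvg_trans cvI; apply: near_eq_cvg; apply: nearW => n /=.
  rewrite /f_ integral_step_fun ?sum_step_height ?factorial_momentE // => l.
  by case/andP: (step_height_bounds k n l g0).
by move/fine_cvgP => [].
Qed.

(** * The recurrence *)

(** With threshold [gamma * n + 1] there is no room for [k + 1] long cycles;
    [long_sum_diff] compares with the threshold [gamma * n].  The detour covers
    the boundary case [gamma = 1 / (k + 1)], where the moments themselves need
    not vanish. *)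
Lemma factorial_moment_cvg0 (R : realType) (k : nat) (gamma : R) :
  1 / k.+1%:R <= gamma -> factorial_moment gamma k.+1 @ \oo --> 0.
Proof.
move=> kg; have g0 : 0 < gamma by apply: lt_le_trans kg; rewrite divr_gt0.
rewrite ler_pdivrMr // in kg.
pose C := k.+1%:R * (2 / gamma) * gamma^-1 ^+ k.
apply: (@squeeze_cvgr _ _ _ _ (fun=> 0) (fun n => C * n%:R^-1)).
- near=> n; rewrite factorial_momentE long_sum_ge0 /=.
  have n0 : 0 < n%:R :> R by rewrite ltr0n; near: n; exact: nbhs_infty_gt.
  have x0 : 0 < gamma * n%:R by rewrite mulr_gt0.
  have xy : gamma * n%:R <= gamma * n%:R + 1 by lra.
  have /andP[_] := long_sum_diff k.+1 n x0 xy.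
  rewrite (@long_sum_eq0 _ (gamma * n%:R + 1)); last first.
    rewrite mulrDr mulrA mulr1 ltr_pwDr ?ltr0n //.
    by rewrite ler_peMl ?ler0n // mulrC.
  rewrite subr0 => /le_trans; apply; rewrite le_eqVlt; apply/orP; left.
  rewrite /C /=; apply/eqP.
  have -> : gamma * n%:R + 1 - gamma * n%:R + 1 = 2 by ring.
  have -> : n%:R / (gamma * n%:R) = gamma^-1 by field; rewrite !gt_eqF.
  by move: (gamma^-1 ^+ k) => P; field; rewrite !gt_eqF.
- exact: cvg_cst.
- rewrite -[X in _ --> X](mulr0 C); apply: cvgM; first exact: cvg_cst.
  exact: inv_nat_cvg.
Unshelve. all: by end_near. Qed.

Lemma Q_eq0 (R : realType) (k : nat) (gamma : R) :
  1 / k.+1%:R <= gamma -> Q k.+1 gamma = 0.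
Proof. by move=> /factorial_moment_cvg0 /cvg_lim; apply. Qed.

Lemma factorial_moment0 (R : realType) (gamma : R) :
  factorial_moment gamma 0 = fun=> 1.
Proof. by apply/funext => n; rewrite factorial_momentE. Qed.

Lemma factorial_moment_is_cvg (R : realType) (k : nat) (gamma : R) :
  0 < gamma -> cvgn (factorial_moment gamma k).
Proof.
elim: k gamma => [|k IH] gamma g0.
  by rewrite factorial_moment0; exact: is_cvg_cst.
by have [_ /cvgP] := long_sum_cvg_integral IH g0.
Qed.

(** For [z >= 1 - k * gamma] the ratio [gamma / (1 - z)] is at least [1 / k],
    hence [Q k] vanishes there; for [k = 0] no such [z < 1] exists. *)
Lemma limit_height_eq0 (R : realType) (gamma : R) (k : nat) (z : R) :
  0 < gamma -> z < 1 -> 1 - k%:R * gamma <= z -> limit_height gamma k z = 0.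
Proof.
case: k => [|k] g0 z1; first by rewrite mul0r subr0 leNgt z1.
move=> kz; rewrite /limit_height; case: ifP => // _.
rewrite Q_eq0 ?mulr0 // ler_pdivlMr ?subr_gt0 //.
by rewrite div1r ler_pdivrMl // lerBlDr addrC -lerBlDr.
Qed.

Lemma integrable_itv_bndo_bndc (R : realType) (a : itv_bound R) (b : R)
    (f : R -> \bar R) :
  (@lebesgue_measure R).-integrable [set` Interval a (BLeft b)] f ->
  (@lebesgue_measure R).-integrable [set` Interval a (BRight b)] f.
Proof.
move=> /integrableP[mf intf]; apply/integrableP; split.
  exact/emeasurable_fun_itv_bndo_bndcP.
rewrite -integral_itv_bndo_bndc //.
by apply: measurableT_comp.
Qed.

Theorem proposition12 (R : realType) :
  [/\ forall (k : nat) (gamma : R), 0 < gamma ->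
        cvgn (factorial_moment gamma k),
      forall gamma : R, 0 < gamma -> Q 0 gamma = 1,
      forall (k : nat) (gamma : R), 0 < gamma -> gamma < 1 / k.+1%:R ->
        (@lebesgue_measure R).-integrable `[gamma, 1 - k%:R * gamma]
          (fun z : R => (1 / z * Q k (gamma / (1 - z)))%:E) /\
        Q k.+1 gamma =
          \int[@lebesgue_measure R]_(z in `[gamma, 1 - k%:R * gamma])
            (1 / z * Q k (gamma / (1 - z)))
    & forall (k : nat) (gamma : R), 1 / k.+1%:R <= gamma -> Q k.+1 gamma = 0].
Proof.
split=> [|gamma g0|k gamma g0 gk|]; first exact: factorial_moment_is_cvg.
- by rewrite /Q factorial_moment0; apply: cvg_lim => //; exact: cvg_cst.
- set b := 1 - k%:R * gamma.
  pose g z := 1 / z * Q k (gamma / (1 - z)).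
  have b1 : b <= 1 by rewrite /b gerBl mulr_ge0 // ltW.
  have [intf cvI] :=
    long_sum_cvg_integral (@factorial_moment_is_cvg R k) g0.
  have sub : `[gamma, b[ `<=` `[0, 1[.
    move=> z /=; rewrite !in_itv /= => /andP[gz zb].
    by rewrite (le_trans (ltW g0) gz) (lt_le_trans zb b1).
  have fg : {in `[gamma, b[%classic, EFin \o limit_height gamma k =1 EFin \o g}.
    move=> z /set_mem /=; rewrite in_itv /= => /andP[gz _].
    by rewrite /limit_height gz.
  have intg : (@lebesgue_measure R).-integrable `[gamma, b[ (EFin \o g).
    apply: (@eq_integrable _ _ R (@lebesgue_measure R) _ _
      (EFin \o limit_height gamma k) (EFin \o g)) => //.
    by apply: integrableS intf => //; exact: sub.
  split; first exact: integrable_itv_bndo_bndc.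
  (* The formula holds on [[0, 1)]; the integrand vanishes off [[gamma, b)],
     and the end point [b] is negligible. *)
  rewrite -Rintegral_itv_bndo_bndc // /Q (cvg_lim _ cvI) //.
  rewrite /Rintegral; congr fine.
  transitivity (\int[@lebesgue_measure R]_(z in `[gamma, b[)
      (EFin \o limit_height gamma k) z)%E; last first.
    by apply: eq_integral => z zI; rewrite fg.
  rewrite integral_mkcond [RHS]integral_mkcond; congr (integral _ _ _).
  apply/funext => z; rewrite /patch.
  case: ifPn => [/set_mem /=|z01]; last first.
    by rewrite memNset // => /sub zz; move: z01; rewrite notin_setE; apply.
  rewrite in_itv /= => /andP[z0 z1].
  case: ifPn => // /negP; rewrite inE /= in_itv /= => zI.
  case: (leP b z) => [bz|zb]; first by rewrite limit_height_eq0.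
  rewrite /limit_height; case: ifP => // gz.
  by rewrite gz zb in zI.
- exact: Q_eq0.
Qed.
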